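(* Let $k$ be a fixed non-negative integer. Then for all sufficiently large integers $d$ (with $d\ge3$) the following holds: if $\nu=\nu(d,k)$ denotes the $(d+k)$-fold convolution on $\mathbb{R}$ of the uniform Cantor measure with contraction factor $1/d$, and $\nu_\pi$ denotes the associated quotient measure on the torus $\mathbb{T}$, then $$\{\dim_{loc}\nu_\pi(x):x\in\operatorname{supp}\nu_\pi\}\subsetneq\{\dim_{loc}\nu(x):x\in\operatorname{supp}\nu,\ x\ne0,\,d+k\}.$$
   Context: The uniform Cantor measure with contraction factor $1/d$ is the unique probability measure $m$ on $\mathbb{R}$ with $m=\frac12 m\circ S_0^{-1}+\frac12m\circ S_1^{-1}$, where $S_0(x)=x/d$ and $S_1(x)=x/d+(1-1/d)$. Its $(d+k)$-fold convolution $\nu$ is the self-similar measure associated with the IFS $\{x\mapsto\frac1dx+\frac{j(d-1)}{d}:j=0,\dots,d+k\}$ and probabilities $\binom{d+k}{j}2^{-(d+k)}$; its support is $[0,d+k]$. $\mathbb{T}=\mathbb{R}/\mathbb{Z}$ with its usual metric, $\pi:\mathbb{R}\to\mathbb{T}$ is the quotient map, and $\nu_\pi(E)=\nu(\pi^{-1}(E))$ for Borel $E\subseteq\mathbb{T}$. The local dimension of a probability measure $\lambda$ at a point $x$ of its support is $\dim_{loc}\lambda(x)=\lim_{r\to0}\frac{\log\lambda(B(x,r))}{\log r}$; sets of local dimensions are taken over the points where the limit exists. *)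

(* Defs.v *)
From HB Require Import structures.
From mathcomp Require Export all_boot all_order all_algebra.
From mathcomp Require Import ring lra zify.
From mathcomp Require Export all_classical all_reals all_analysis.

Set Implicit Arguments.
Unset Strict Implicit.
Unset Printing Implicit Defensive.

Import Order.TTheory GRing.Theory Num.Theory.
Export numFieldNormedType.Exports.

Local Open Scope classical_set_scope.
Local Open Scope ring_scope.
Local Open Scope quotient_scope.

Section cantor_measure.
Context {R : realType}.

(* For d >= 2 exactly one Borel probability measure satisfies this equation
   (Hutchinson), so quantifying over its solutions denotes the uniform Cantor
   measure with contraction factor 1 / d. *)
Definition is_cantor_measure (d : nat) (m : probability R R) : Prop :=
  forall A : set R, measurable A ->
    m A = ((2^-1)%:E * m ((fun x : R => x / d%:R)%R @^-1` A) +
           (2^-1)%:E * m ((fun x : R => x / d%:R + (1 - d%:R^-1))%R @^-1` A))%E.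

End cantor_measure.

Section convolution.
Context {R : realType}.

Definition sumR (p : R * R) : R := p.1 + p.2.

Let measurable_sumR : measurable_fun [set: R * R] sumR.
Proof. exact: measurable_realfun.measurable_funD. Qed.

HB.instance Definition _ :=
  isMeasurableFun.Build _ _ _ _ sumR measurable_sumR.

Definition convolution (m1 m2 : probability R R) : probability R R :=
  distribution (m1 \x m2)%E sumR.

Fixpoint convolution_pow (m : probability R R) (n : nat) : probability R R :=
  if n is n'.+1 then convolution m (convolution_pow m n') else dirac (0 : R).

End convolution.

Section torus.
Context (R : realType).

Definition eq_mod1 (x y : R) : bool := x - y \is a Num.int.

Let eq_mod1_refl : reflexive eq_mod1.
Proof. by move=> x; rewrite /eq_mod1 subrr rpred0. Qed.
Let eq_mod1_sym : symmetric eq_mod1.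
Proof. by move=> x y; rewrite /eq_mod1 -opprB rpredN. Qed.
Let eq_mod1_trans : transitive eq_mod1.
Proof.
by move=> y x z xy yz; rewrite /eq_mod1 -(subrKA y) rpredD.
Qed.

Canonical eq_mod1_equiv :=
  EquivRel eq_mod1 eq_mod1_refl eq_mod1_sym eq_mod1_trans.

Definition torus : Type := {eq_quot eq_mod1_equiv}.

HB.instance Definition _ := Quotient.on torus.
HB.instance Definition _ := Choice.on torus.

Definition to_torus (x : R) : torus := \pi_torus x.

HB.instance Definition _ := isPointed.Build torus (to_torus 0).

Definition dist_mod1 (x y : R) : R :=
  inf (range (fun n : int => `|x - y - n%:~R| : R)).

Lemma dist_mod1_lb x y : has_lbound (range (fun n : int => `|x - y - n%:~R| : R)).
Proof. by exists 0 => _ [n _ <-]. Qed.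

Lemma dist_mod1_le x y (n : int) : dist_mod1 x y <= `|x - y - n%:~R|.
Proof. by apply: ge_inf; [exact: dist_mod1_lb|exists n]. Qed.

Lemma dist_mod1_ge0 x y : 0 <= dist_mod1 x y.
Proof.
apply: lb_le_inf; first by exists `|x - y - 0%:~R|; exists 0.
by move=> _ [n _ <-].
Qed.

Lemma dist_mod1_approx x y e : 0 < e ->
  exists n : int, `|x - y - n%:~R| < dist_mod1 x y + e.
Proof.
move=> e0; have hi : has_inf (range (fun n : int => `|x - y - n%:~R| : R)).
  by split; [exists `|x - y - 0%:~R|; exists 0|exact: dist_mod1_lb].
by have [_ [n _ <-] ?] := inf_adherent e0 hi; exists n.
Qed.

Lemma dist_mod1_sym x y : dist_mod1 x y = dist_mod1 y x.
Proof.
suff le a b : dist_mod1 a b <= dist_mod1 b a.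
  by apply/eqP; rewrite eq_le !le.
apply/ler_addgt0Pl => e e0; have [n hn] := dist_mod1_approx b a e0.
rewrite addrC (le_trans _ (ltW hn))// -normrN opprB opprB addrC.
by rewrite (le_trans (dist_mod1_le _ _ (- n)))// rmorphN/= opprK addrC.
Qed.

Lemma dist_mod1_triangle y x z :
  dist_mod1 x z <= dist_mod1 x y + dist_mod1 y z.
Proof.
apply/ler_addgt0Pl => e e0; have e20 : 0 < e / 2 by rewrite divr_gt0.
have [n hn] := dist_mod1_approx x y e20.
have [p hp] := dist_mod1_approx y z e20.
rewrite (le_trans (dist_mod1_le _ _ (n + p)))// rmorphD/=.
have -> : x - z - (n%:~R + p%:~R) = (x - y - n%:~R) + (y - z - p%:~R) by ring.
apply: le_trans (ler_normD _ _) _; move/ltW: hn; move/ltW: hp.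
by move=> hp hn; lra.
Qed.

Lemma dist_mod1_eq0 x y : (dist_mod1 x y == 0) = eq_mod1 x y.
Proof.
apply/eqP/idP => [d0|/intrP[n xyn]]; last first.
  apply/eqP; rewrite eq_le dist_mod1_ge0 andbT.
  by rewrite (le_trans (dist_mod1_le x y n))// xyn subrr normr0.
have h0 : 0 < 2^-1 :> R by rewrite invr_gt0.
have [n hn] := dist_mod1_approx x y h0; rewrite d0 add0r in hn.
suff xyn : `|x - y - n%:~R| <= 0.
  by rewrite normr_le0 subr_eq0 in xyn; rewrite /eq_mod1 (eqP xyn) intr_int.
rewrite leNgt; apply/negP => xyn.
have [p] := dist_mod1_approx x y xyn; rewrite d0 add0r => hp.
have : `|(n - p)%:~R| < 1 :> R.
  have -> : (n - p)%:~R = (x - y - p%:~R) - (x - y - n%:~R) :> R.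
    by rewrite rmorphB/=; ring.
  rewrite (le_lt_trans (ler_normB _ _))// [ltRHS]splitr mul1r ltrD//.
  exact: lt_trans hp hn.
rewrite -intr_norm -[1]/(1%:~R) ltr_int => np.
have {}np : n - p = 0 by lia.
by move: hp; rewrite (subr0_eq np) ltxx.
Qed.

Lemma dist_mod1_repr (x y x' y' : R) : eq_mod1 x x' -> eq_mod1 y y' ->
  dist_mod1 x y = dist_mod1 x' y'.
Proof.
suff le a b a' b' : eq_mod1 a a' -> eq_mod1 b b' ->
    dist_mod1 a' b' <= dist_mod1 a b.
  by move=> xx yy; apply/eqP; rewrite eq_le !le// eq_mod1_sym.
rewrite -!dist_mod1_eq0 => /eqP aa /eqP bb.
rewrite (le_trans (dist_mod1_triangle a _ _))// dist_mod1_sym aa add0r.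
by rewrite (le_trans (dist_mod1_triangle b _ _))// bb addr0.
Qed.

Definition torus_dist (x y : torus) : R := dist_mod1 (repr x) (repr y).

Lemma torus_distE (x y : R) :
  torus_dist (to_torus x) (to_torus y) = dist_mod1 x y.
Proof.
apply: dist_mod1_repr; rewrite -[eq_mod1 _ _]/(eq_mod1_equiv _ _).
- by rewrite -eqmodE reprK.
- by rewrite -eqmodE reprK.
Qed.

Let torus_distxx x : torus_dist x x = 0.
Proof. by apply/eqP; rewrite /torus_dist dist_mod1_eq0 eq_mod1_refl. Qed.

Let torus_dist_positivity x y : torus_dist x y = 0 -> x = y.
Proof.
move/eqP; rewrite /torus_dist dist_mod1_eq0 => xy.
by rewrite -(reprK x) -(reprK y); apply/eqP; rewrite eqmodE.
Qed.

Let torus_dist_sym x y : torus_dist x y = torus_dist y x.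
Proof. exact: dist_mod1_sym. Qed.

Let torus_dist_triangle y x z :
  torus_dist x z <= torus_dist x y + torus_dist y z.
Proof. exact: dist_mod1_triangle. Qed.

HB.instance Definition _ := isMetric.Build R torus
  torus_distxx torus_dist_positivity torus_dist_sym torus_dist_triangle.

HB.instance Definition _ := @isMeasurable.Build default_measure_display torus
  <<s @open torus >> (@sigma_algebra0 _ setT _) (@sigma_algebraC _ _)
  (@sigma_algebra_bigcup _ setT _).

Lemma continuous_to_torus : continuous to_torus.
Proof.
move=> x; apply/cvg_ballP => e e0; near=> y.
rewrite ballEmdist/= [ltLHS]torus_distE.
rewrite (le_lt_trans (dist_mod1_le _ _ 0))// subr0.
by near: y; exact: (@cvgr_dist_lt _ _ _ _ _ id).
Unshelve. all: by end_near.
Qed.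

Let measurable_to_torus : measurable_fun [set: R] to_torus.
Proof.
apply: (@measurability _ _ _ _ setT to_torus (@open torus)) => // _ [B oB <-].
rewrite setTI; apply: measurable_realfun.open_measurable.
by move/continuousP: continuous_to_torus; exact.
Qed.

HB.instance Definition _ :=
  isMeasurableFun.Build _ _ _ _ to_torus measurable_to_torus.

Definition torus_quotient_measure (m : probability R R) :
  probability torus R := distribution m to_torus.

End torus.

Section local_dimension.
Context {R : realType}.

Definition measure_support (T : topologicalType) (mu : set T -> \bar R) :
    set T :=
  [set x | forall U : set T, open U -> U x -> (0 < mu U)%E].

(* The quotient is only taken for r > 0; at a point of the support of a
   probability measure [mu (ball x r)] is positive and finite, so neither [fine]
   nor [ln] hits a default value, and [ln r != 0] for r near 0. *)
Definition is_local_dim (T : pseudoMetricType R) (mu : set T -> \bar R)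
    (x : T) (l : R) : Prop :=
  ln (fine (mu (ball x r))) / ln r @[r --> 0^'+] --> l.

Definition local_dims (T : pseudoMetricType R) (mu : set T -> \bar R)
    (A : set T) : set R :=
  [set l | exists2 x, A x & is_local_dim mu x l].

End local_dimension.

(* Main.v *)
Require Import Defs.
From HB Require Import structures.
From mathcomp Require Import ring lra zify measurable_realfun.

Set Implicit Arguments.
Unset Strict Implicit.
Unset Printing Implicit Defensive.

Import Order.TTheory GRing.Theory Num.Theory.

Local Open Scope classical_set_scope.
Local Open Scope ring_scope.

(* Let [n = d + k], [p_j = 'C(n, j) / 2 ^ n], [P = p_(n/2)], [Q = p_(k+2)].

   Overlaps of first-level pieces of [nu] involve only digits near [0] or [n],
   whose weights are much smaller than [P]; hence [nu (B(y, d^-N)) <= 2 P^N]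
   for all [y], and the local dimensions of [nu] and [nu_pi] are at least
   [- ln P / ln d].

   On the torus, the integer parts of the [d - 1] representatives
   [x, ..., x + d - 2] are permuted by the shift, so the product of their
   masses is at least the [N]-th power of the product of
   [min (p_j, p_(j+1))], [j < d - 1].  For [d] large this product exceeds
   [Q ^ (d - 1)], so the local dimensions of [nu_pi] are strictly less than
   [- ln Q / ln d].

   Points whose digits are all [n/2] or [k + 2] have a unique expansion, lie
   in [[k + 2, n/2]], and prescribing the digit frequencies realises every
   value of [[- ln P / ln d, - ln Q / ln d]] as a local dimension of [nu]. *)

(** * Binomial estimates *)

Section binomial_estimates.
Local Open Scope nat_scope.

(** From ['C(n, a) * 'C(a, b) = 'C(n, b) * 'C(n - b, a - b)] it suffices that
    ['C(a, a - b) <= 'C(n - b, a - b)], which holds since [a <= n - b]. *)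
Lemma leq_bin_inner n a b : b <= a -> a + b <= n -> 'C(n, b) <= 'C(n, a).
Proof.
move=> ba abn.
have b0 : 0 < 'C(a, b) by rewrite bin_gt0.
rewrite -(leq_pmul2r b0).
have -> : 'C(n, a) * 'C(a, b) = 'C(n, b) * 'C(n - b, a - b).
  have f0 : 0 < b`! * (a - b)`! * (n - a)`! by rewrite !muln_gt0 !fact_gt0.
  apply/eqP; rewrite -(eqn_pmul2r f0); apply/eqP.
  transitivity (n`!).
    rewrite -(@bin_fact n a); last lia.
    rewrite -(@bin_fact a b)//; ring.
  rewrite -(@bin_fact n b); last lia.
  rewrite -(@bin_fact (n - b) (a - b)); last lia.
  have -> : n - b - (a - b) = n - a by lia.
  ring.
rewrite leq_mul2l -[in 'C(a, b)](@bin_sub a b)// leq_bin2l ?orbT//; lia.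
Qed.

Lemma leq_bin_half n a : 'C(n, a) <= 'C(n, n./2).
Proof.
have [an|na] := leqP a n; last by rewrite bin_small.
have [ah|ha] := leqP a n./2; first by apply: leq_bin_inner => //; lia.
by rewrite -bin_sub//; apply: leq_bin_inner; lia.
Qed.

Lemma leq_bin_exp n a : 'C(n, a) <= n ^ a.
Proof.
elim: a => [|a IH]; first by rewrite bin0.
rewrite (@leq_trans (a.+1 * 'C(n, a.+1)))// ?leq_pmull// mul_bin_left expnS.
by rewrite leq_mul// leq_subr.
Qed.

Lemma bin_step4 n a : 5 * a + 4 <= n -> 4 * 'C(n, a) <= 'C(n, a.+1).
Proof.
move=> an; rewrite -(@leq_pmul2l a.+1)// mul_bin_left mulnA leq_mul2r.
by apply/orP; right; lia.
Qed.

(** With [L = 2K] and [m = n %/ L > L] one gets [n < (m + 1) L <= m ^ 2], hence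
    [n ^ K <= m ^ L < (2 ^ m) ^ L <= 2 ^ n]. *)
Lemma expn_lt_exp2 K n : 0 < K -> 2 * K * (2 * K).+1 <= n -> n ^ K < 2 ^ n.
Proof.
case: K => // K _.
set L := 2 * K.+1; move=> Ln.
have L0 : 0 < L by [].
set m := n %/ L.
have Lm : L.+1 <= m by rewrite leq_divRL// mulnC.
have nm : n < m.+1 * L by rewrite -ltn_divLR.
have mn : m * L <= n by rewrite leq_divM.
rewrite (@leq_ltn_trans ((m ^ 2) ^ K.+1))//.
  by rewrite leq_exp2r// (leq_trans (ltnW nm))// -mulnn; nia.
rewrite -expnM -/L (@leq_trans ((2 ^ m) ^ L))//.
  by rewrite ltn_exp2r// ltn_expl.
by rewrite -expnM leq_exp2l.
Qed.

(* Outside a bounded number of positions near the two ends, the factors exceed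
   [4 * 'C(n, k.+2)], and this exponential gain beats the polynomial size of
   ['C(n, k.+2)]. *)
Lemma prod_min_bin_gt k d :
  2 * (k.+2 * (k + 7)) * (2 * (k.+2 * (k + 7))).+1 + 5 * k + 20 <= d ->
  'C(d + k, k.+2) ^ d.-1 <
  \prod_(m < d.-1) minn 'C(d + k, m) 'C(d + k, m.+1).
Proof.
set K := k.+2 * (k + 7); set n := d + k; set B := 'C(n, k.+2) => dK.
have nB : 0 < B by rewrite bin_gt0; lia.
have B4 : 4 * B <= 'C(n, k + 4).
  rewrite (@leq_trans (4 * 'C(n, k.+3)))//.
    by rewrite leq_mul2l/=; apply: leq_bin_inner; lia.
  by rewrite addnC; apply: bin_step4; lia.
(* The factors with [k + 4 <= m < d - 4] are at least [4 * B]; all others are at least 1. *)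
apply: (@leq_trans ((4 * B) ^ (d - 4 - (k + 4)))); last first.
  rewrite -(big_mkord xpredT (fun m => minn 'C(n, m) 'C(n, m.+1))).
  rewrite (@big_cat_nat _ _ _ (k + 4) 0 d.-1)//=; last by lia.
  rewrite (@big_cat_nat _ _ _ (d - 4) (k + 4) d.-1)//=; [|lia|lia].
  rewrite -[X in X <= _]mul1n leq_mul//.
    rewrite big_seq; elim/big_ind: _ => // [x y x0 y0|i].
      by rewrite muln_gt0 x0.
    by rewrite mem_index_iota => im; rewrite leq_min !bin_gt0; lia.
  rewrite -[X in X <= _]muln1 leq_mul//.
    rewrite -prod_nat_const_nat !big_seq; apply: leq_prod => i.
    rewrite mem_index_iota => im; rewrite leq_min.
    by apply/andP; split; apply: (leq_trans B4); apply: leq_bin_inner; lia.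
  rewrite big_seq; elim/big_ind: _ => // [x y x0 y0|i].
    by rewrite muln_gt0 x0.
  by rewrite mem_index_iota => im; rewrite leq_min !bin_gt0; lia.
set e := d - 4 - (k + 4).
(* Cancelling [B ^ e] leaves [B ^ (k + 7) < 4 ^ e], which follows from [B <= n ^ k.+2],
   [n ^ K < 2 ^ n] and [n <= 2 * e]. *)
have -> : d.-1 = (e + (k + 7))%N by lia.
rewrite expnD expnMn mulnC ltn_pmul2r ?expn_gt0 ?nB//.
rewrite (@leq_ltn_trans (n ^ K))//.
  by rewrite /K expnM leq_exp2r ?leq_bin_exp//; lia.
rewrite (@leq_trans (2 ^ n))//; first by apply: expn_lt_exp2; lia.
by rewrite -[4]/(2 ^ 2) -expnM leq_exp2l//; lia.
Qed.

End binomial_estimates.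

(** * Self-similarity of the convolution powers *)

Section self_similarity.
Context {R : realType}.

Definition ifs_map (d j : nat) (x : R) : R := x / d%:R + j%:R * (1 - d%:R^-1).

Definition bin_weight (n j : nat) : R := 'C(n, j)%:R / 2 ^+ n.

Lemma bin_weight_ge0 n j : 0 <= bin_weight n j.
Proof. by rewrite divr_ge0. Qed.

(** Pascal's rule: adding an independent fair digit 0 or 1 to a binomial digit of order [n] gives
    one of order [n.+1]. *)
Lemma pascal_bin_weight (n : nat) (c : nat -> R) :
  \sum_(j < n.+1) bin_weight n j * (2^-1 * c j + 2^-1 * c j.+1) =
  \sum_(j < n.+2) bin_weight n.+1 j * c j.
Proof.
rewrite [RHS]big_ord_recl/=.
have pascal i : bin_weight n.+1 i.+1 * c i.+1 =
    bin_weight n i * (2^-1 * c i.+1) + bin_weight n i.+1 * (2^-1 * c i.+1).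
  by rewrite /bin_weight binS natrD exprS invfM; ring.
rewrite (eq_bigr (fun j : 'I__ => bin_weight n j * (2^-1 * c j) +
  bin_weight n j * (2^-1 * c j.+1))); last by move=> j _; rewrite mulrDr.
rewrite [X in _ = _ + X](eq_bigr (fun i : 'I__ => bin_weight n i * (2^-1 * c i.+1) +
  bin_weight n i.+1 * (2^-1 * c i.+1)) (fun i _ => pascal i)).
rewrite !big_split/= [in LHS]addrC [RHS]addrCA; congr (_ + _).
rewrite big_ord_recl/= [in RHS]big_ord_recr/=.
rewrite [X in _ = _ + (_ + X)](_ : _ = 0) ?addr0; last first.
  by rewrite /bin_weight bin_small// mul0r mul0r.
congr (_ + _).
by rewrite /bin_weight !bin0 exprS invfM; ring.
Qed.

Lemma measurable_ifs_map d j : measurable_fun [set: R] (ifs_map d j).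
Proof.
by apply: measurable_funD => //; exact: measurable_funM.
Qed.

Local Open Scope ereal_scope.

Lemma convolutionE (m1 m2 : probability R R) (A : set R) :
  convolution m1 m2 A = \int[m1]_x m2 ((fun y => (x + y)%R) @^-1` A).
Proof.
rewrite /convolution/= /distribution /pushforward/= /product_measure1.
apply: eq_integral => x _ /=; congr (m2 _).
by rewrite xsectionE.
Qed.

Lemma measurable_preimage_addl (A : set R) (x : R) : measurable A ->
  measurable ((fun y => (x + y)%R) @^-1` A).
Proof.
move=> mA; rewrite -[X in measurable X]setTI.
by apply: measurable_funD.
Qed.

Variables (d : nat) (m : probability R R).
Hypothesis m_cantor : is_cantor_measure d m.

(** The defining equation says that [m] agrees on measurable sets with a sum of two halved image
    measures; integration against that sum gives the formula. *)
Lemma cantor_integral (f : R -> \bar R) :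
  measurable_fun [set: R] f -> (forall x, 0 <= f x) ->
  \int[m]_x f x = (2^-1)%:E * \int[m]_x f (ifs_map d 0 x) +
                  (2^-1)%:E * \int[m]_x f (ifs_map d 1 x).
Proof.
move=> mf f0.
have mS j := measurable_ifs_map d j.
pose S j : {mfun R >-> R} := HB.pack (ifs_map d j)
  (isMeasurableFun.Build _ _ _ _ (ifs_map d j) (mS j)).
pose half : {nonneg R} := NngNum (eqbRL (invr_ge0 (2 : R)) (ler0n R 2)).
pose mu := measure_add (mscale half (distribution m (S 0%N)))
                       (mscale half (distribution m (S 1%N))).
rewrite (eq_measure_integral mu) => [|A mA _]; last first.
  rewrite [RHS]measure_addE /mscale/= m_cantor//; congr (_ * m _ + _ * m _).
    by apply/seteqP; split => x /=; rewrite /pushforward/= /ifs_map mul0r addr0.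
  by apply/seteqP; split => x /=; rewrite /pushforward/= /ifs_map mul1r.
rewrite ge0_integral_measure_add// !ge0_integral_mscale//=.
by rewrite !ge0_integral_pushforward.
Qed.

(** Induction on [n]: both convolution factors are expanded into digits, and the digits add up
    because [ifs_map d i x + ifs_map d j y = ifs_map d (i + j) (x + y)]. The weights are then
    collected by Pascal's rule. *)
Lemma convolution_pow_self_similar (n : nat) (A : set R) : measurable A ->
  convolution_pow m n A =
  \sum_(j < n.+1) (bin_weight n j)%:E * convolution_pow m n (ifs_map d j @^-1` A).
Proof.
elim: n A => [|n IH] A mA.
  rewrite big_ord1/= /bin_weight bin0 expr0 divr1 mul1e.
  rewrite /dirac/= !indicE; congr ((nat_of_bool _)%:R%:E).
  by apply/idP/idP; rewrite !inE /preimage/= /ifs_map !mul0r addr0.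
set nu := convolution_pow m n.
have mT j (B : set R) : measurable B -> measurable (ifs_map d j @^-1` B).
  by move=> mB; rewrite -[X in measurable X]setTI; exact: measurable_ifs_map.
rewrite [LHS]convolutionE.
have split_digit x : nu ((fun y => (x + y)%R) @^-1` A) =
    \sum_(j < n.+1) (bin_weight n j)%:E *
      nu ((fun y => (x + ifs_map d j y)%R) @^-1` A).
  by rewrite IH//; exact: measurable_preimage_addl.
under eq_integral do rewrite split_digit.
have mfib (j : nat) : measurable_fun [set: R]
    (fun x => nu ((fun y => (x + ifs_map d j y)%R) @^-1` A)).
  pose g (p : R * R) := (p.1 + ifs_map d j p.2)%R.
  have mg : measurable_fun [set: R * R] g.
    apply: measurable_funD => //.
    exact: measurableT_comp (measurable_ifs_map d j) _.
  have -> : (fun x => nu ((fun y => (x + ifs_map d j y)%R) @^-1` A)) =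
      (fun x => nu (xsection (g @^-1` A) x)).
    by apply/funext => x; rewrite xsectionE.
  apply: measurable_fun_xsection; rewrite -[X in measurable X]setTI; exact: mg.
rewrite ge0_integral_sum//; last 2 first.
  by move=> j; apply: measurable_funeM.
  by move=> j x _; rewrite mule_ge0// lee_fin bin_weight_ge0.
have fibE (i j : nat) : \int[m]_x
    nu ((fun y => (ifs_map d i x + ifs_map d j y)%R) @^-1` A) =
    convolution_pow m n.+1 (ifs_map d (i + j) @^-1` A).
  rewrite [RHS]convolutionE; apply: eq_integral => x _; congr (nu _).
  by apply/seteqP; split => y; rewrite /preimage/= /ifs_map natrD; congr (A _); ring.
pose c j := fine (convolution_pow m n.+1 (ifs_map d j @^-1` A)).
have cE j : convolution_pow m n.+1 (ifs_map d j @^-1` A) = (c j)%:E.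
  by rewrite /c fineK// fin_num_measure//; exact: mT.
under [RHS]eq_bigr do rewrite cE -EFinM.
rewrite sumEFin -pascal_bin_weight -sumEFin; apply: eq_bigr => j _.
rewrite ge0_integralZl_EFin ?bin_weight_ge0// cantor_integral//.
by rewrite !fibE add0n add1n !cE.
Qed.

End self_similarity.

(** * Masses of balls on the line: recursion and support *)

Section ball_mass.
Context {R : realType}.
Variables (d n : nat) (m : probability R R).
Hypotheses (d_ge2 : (2 <= d)%N) (m_cantor : is_cantor_measure d m).

Local Notation nu := (convolution_pow m n).

Definition ball_mass (y r : R) : R := fine (nu (ball y r)).

Let d_gt0 : 0 < d%:R :> R. Proof. by rewrite ltr0n; lia. Qed.

Let measurable_ifs_preimage j (A : set R) :
  measurable A -> measurable (ifs_map d j @^-1` A).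
Proof.
by move=> mA; rewrite -[X in measurable X]setTI; exact: measurable_ifs_map.
Qed.

Lemma fine_self_similar (A : set R) : measurable A ->
  fine (nu A) = \sum_(j < n.+1) bin_weight n j * fine (nu (ifs_map d j @^-1` A)).
Proof.
move=> mA; rewrite (convolution_pow_self_similar m_cantor)//.
rewrite [RHS](_ : _ = fine (\sum_(j < n.+1)
    (bin_weight n j * fine (nu (ifs_map d j @^-1` A)))%:E)%E); last first.
  by rewrite sumEFin.
congr fine; apply: eq_bigr => j _; rewrite [in RHS]EFinM fineK//.
by rewrite fin_num_measure//; exact: measurable_ifs_preimage.
Qed.

Lemma le_fine_measure (A B : set R) : measurable A -> measurable B ->
  A `<=` B -> fine (nu A) <= fine (nu B).
Proof.
move=> mA mB AB; rewrite fine_le ?fin_num_measure//.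
by apply: le_measure => //; rewrite inE.
Qed.

(** Self-similarity applied to the whole line replaces the binomial theorem. *)
Lemma sum_bin_weight : \sum_(j < n.+1) bin_weight n j = 1 :> R.
Proof.
have := @fine_self_similar setT measurableT; rewrite probability_setT.
rewrite -[fine 1]/(1 : R) => ->; apply: eq_bigr => j _.
by rewrite mulr1.
Qed.

Let outer (t : R) : set R := [set x | x < - t] `|` [set x | n%:R + t < x].

Let measurable_outer t : measurable (outer t).
Proof.
apply: measurableU.
  have -> : [set x | x < - t] = `]-oo, (- t)[%classic.
    by apply/seteqP; split => x/=; rewrite in_itv.
  exact: measurable_itv.
have -> : [set x | n%:R + t < x] = `](n%:R + t), +oo[%classic.
  by apply/seteqP; split => x/=; rewrite in_itv/= andbT.
exact: measurable_itv.
Qed.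

Let ifs_map_outer t j : (j <= n)%N -> ifs_map d j @^-1` outer t `<=` outer (d%:R * t).
Proof.
move=> jn x; rewrite /preimage/outer/ifs_map/=.
have -> : x / d%:R + j%:R * (1 - d%:R^-1) = (x + j%:R * (d%:R - 1)) / d%:R.
  by field; rewrite gt_eqF.
have j0 : 0 <= j%:R :> R by [].
have d2 : 2 <= d%:R :> R by rewrite ler_nat.
have {}jn : j%:R <= n%:R :> R by rewrite ler_nat.
rewrite ltr_pdivrMr// ltr_pdivlMr//.
by case=> h; [left|right]; nra.
Qed.

Let outer_le t : fine (nu (outer t)) <= fine (nu (outer (d%:R * t))).
Proof.
rewrite fine_self_similar// -[leRHS]mul1r -[X in _ <= X * _]sum_bin_weight mulr_suml.
apply: ler_sum => j _; apply: ler_wpM2l; first exact: bin_weight_ge0.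
apply: le_fine_measure => //; first exact: measurable_ifs_preimage.
by apply: (@ifs_map_outer t j); rewrite -ltnS.
Qed.

(* [T_j^-1] expands the complement of [[-t, n + t]] into that of
   [[-d t, n + d t]], so the mass outside the former is at most the mass
   outside the latter. *)
Lemma outer_mass0 t : 0 < t -> nu (outer t) = 0%E.
Proof.
move=> t0.
(* The sets [G N] decrease to the empty set, so their masses tend to 0, and each of these masses
   bounds that of [outer t]. *)
pose G N := outer (d%:R ^+ N * t).
have GE N : fine (nu (outer t)) <= fine (nu (G N)).
  elim: N => [|N IH]; first by rewrite /G expr0 mul1r.
  by rewrite (le_trans IH)// (le_trans (outer_le _))// /G mulrA -exprS.
have G0 : \bigcap_N G N = set0.
  apply/seteqP; split => // x Gx.
  have [N xN] : exists N, `|x| + n%:R <= d%:R ^+ N * t.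
    exists (Num.truncn ((`|x| + n%:R) / t)).+1.
    rewrite -ler_pdivrMr// (le_trans (ltW (truncnS_gt _)))//.
    by rewrite -natrX ler_nat (leq_trans _ (ltnW (ltn_expl _ _))).
  have := Gx N I; have := ler_norm x; have := ler_norm (- x); rewrite normrN.
  have : 0 <= n%:R :> R by [].
  by move=> n0 x1 x2 [] /= h; lra.
have cG : nu (G N) @[N --> \oo] --> 0%E.
  rewrite -(measure0 nu) -G0; apply: nonincreasing_cvg_mu => //.
  - rewrite -ge0_fin_numE ?measure_ge0//; apply: fin_num_measure.
    exact: measurable_outer.
  - by move=> N; exact: measurable_outer.
  - by rewrite G0.
  - apply/nonincreasing_seqP => N; apply/subsetPset.
    have le : d%:R ^+ N * t <= d%:R ^+ N.+1 * t.
      rewrite ler_pM2r// exprS ler_peMl ?exprn_ge0//.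
      by rewrite -[1]/(1%:R) ler_nat; lia.
    by move=> x [] /= h; [left|right] => /=; lra.
apply/eqP; rewrite eq_le measure_ge0 andbT.
apply: (cvge_to_ge cG); near=> N.
have fin_outer s : nu (outer s) = (fine (nu (outer s)))%:E.
  by rewrite fineK// fin_num_measure//; exact: measurable_outer.
by rewrite fin_outer [leRHS]fin_outer lee_fin; exact: GE.
Unshelve. all: by end_near.
Qed.

Lemma ball_mass_ge0 y r : 0 <= ball_mass y r.
Proof. by rewrite fine_ge0. Qed.

Lemma ball_mass_le1 y r : ball_mass y r <= 1.
Proof.
rewrite -lee_fin fineK; last by rewrite fin_num_measure//; exact: measurable_ball.
by apply: probability_le1; exact: measurable_ball.
Qed.

Lemma le_ball_mass y r s : r <= s -> ball_mass y r <= ball_mass y s.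
Proof.
move=> rs; apply: le_fine_measure; [exact: measurable_ball..|].
exact: le_ball.
Qed.

Lemma ball_mass_rec y r : ball_mass y r =
  \sum_(j < n.+1) bin_weight n j *
    ball_mass (d%:R * y - j%:R * (d%:R - 1)) (d%:R * r).
Proof.
rewrite /ball_mass fine_self_similar; last exact: measurable_ball.
apply: eq_bigr => j _; congr (_ * fine (nu _)).
apply/seteqP; split => z; rewrite /preimage/= -ball_normE/=.
all: rewrite -[X in `|X - z|](_ : d%:R * (y - j%:R * (1 - d%:R^-1)) = _);
  last by field; rewrite gt_eqF.
all: rewrite (_ : _ - z = d%:R * (y - ifs_map d j z));
  last by rewrite /ifs_map; field; rewrite gt_eqF.
all: by rewrite normrM gtr0_norm// ltr_pM2l.
Qed.

Lemma ball_mass_outside y r : y < - r \/ n%:R + r < y -> ball_mass y r = 0.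
Proof.
move=> yr; rewrite /ball_mass.
(* The strict inequality leaves room for some [t > 0] with the ball inside [outer t]. *)
have [t t0 yt] : exists2 t, 0 < t & y + t < - r \/ n%:R + r + t < y.
  case: yr => yr.
    by exists ((- r - y) / 2); [lra|left; lra].
  by exists ((y - n%:R - r) / 2); [lra|right; lra].
suff : (nu (ball y r) <= 0)%E.
  rewrite measure_le0 => /eqP ->; by [].
rewrite -(outer_mass0 t0); apply: le_measure; rewrite ?inE//.
  exact: measurable_ball.
move=> z; rewrite -ball_normE/= ltr_norml => /andP[h1 h2].
by case: yt => yt; [left|right] => /=; lra.
Qed.

Lemma ball_mass_full y r : 0 <= y <= n%:R -> n%:R < r -> ball_mass y r = 1.
Proof.
move=> /andP[y0 yn] nr; rewrite /ball_mass.
have t0 : 0 < (r - n%:R) / 2 by lra.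
suff -> : nu (ball y r) = 1%E by [].
have mB := measurable_ball y r.
apply/eqP; rewrite eq_le probability_le1//=.
rewrite -(@probability_setT _ _ _ nu) -(setvU (ball y r)).
rewrite measureU ?setICl//; last exact: measurableC.
rewrite [X in (X + _)%E](_ : _ = 0%E) ?add0e//.
apply/eqP; rewrite -measure_le0 -(outer_mass0 t0).
apply: le_measure; rewrite ?inE//; first exact: measurableC.
move=> z; rewrite -ball_normE/= => /negP; rewrite -leNgt ler_normr.
by case/orP => h; [left|right] => /=; lra.
Qed.

(** * Comparison of balls on the torus with balls on the line *)

Local Notation nu_pi := (torus_quotient_measure nu).

(** Since the ball is open, an integer that nearly realises the infimum in [dist_mod1] is enough. *)
Lemma to_torus_ballP (t z r : R) :
  ball (to_torus t) r (to_torus z) <-> exists i : int, ball (t + i%:~R) r z.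
Proof.
rewrite ballEmdist/= [X in X < r](torus_distE t z); split.
  move=> h; have e0 : 0 < r - dist_mod1 t z by rewrite subr_gt0.
  have [i hi] := dist_mod1_approx t z e0; exists (- i).
  by rewrite -ball_normE/= rmorphN/= addrAC (lt_le_trans hi)// addrC subrK.
move=> [i]; rewrite -ball_normE/= => h.
rewrite (le_lt_trans (dist_mod1_le t z (- i)))// rmorphN/= opprK addrAC.
by [].
Qed.

Lemma measurable_preimage_torus_ball (t r : R) :
  measurable (@to_torus R @^-1` ball (to_torus t) r).
Proof.
apply: open_measurable.
have -> : @to_torus R @^-1` ball (to_torus t) r =
    \bigcup_(i : int) ball (t + i%:~R) r.
  by apply/seteqP; split => z /=; [move=> /to_torus_ballP[i ?]; exists i|
    move=> [i _ ?]; apply/to_torus_ballP; exists i].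
by apply: bigcup_open => i _; exact: ball_open.
Qed.

Lemma to_torus_surj (x : torus R) : exists2 t, 0 <= t < 1 & x = to_torus t.
Proof.
exists (repr x - (Num.floor (repr x))%:~R).
  have := floor_itv (repr x); rewrite rmorphD/= => /andP[? ?].
  by apply/andP; split; lra.
rewrite -[LHS](reprK x); apply/eqmodP => /=.
by rewrite /eq_mod1 opprB addrC subrK intr_int.
Qed.

Lemma torus_mass_ge (t r : R) (i : int) :
  ball_mass (t + i%:~R) r <= fine (nu_pi (ball (to_torus t) r)).
Proof.
apply: le_fine_measure; [exact: measurable_ball|
  exact: measurable_preimage_torus_ball|].
by move=> z zt; apply/to_torus_ballP; exists i.
Qed.

Lemma le_torus_mass (x : torus R) (r s : R) : r <= s ->
  fine (nu_pi (ball x r)) <= fine (nu_pi (ball x s)).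
Proof.
have [t _ ->] := to_torus_surj x.
move=> rs; apply: le_fine_measure; [exact: measurable_preimage_torus_ball..|].
by move=> z; exact: le_ball.
Qed.

Lemma torus_mass_le (t r c : R) : 0 <= t < 1 -> r <= 1 ->
  (forall y, ball_mass y r <= c) ->
  fine (nu_pi (ball (to_torus t) r)) <= (n + 4)%:R * c.
Proof.
move=> /andP[t0 t1] r1 yc.
(* A translate [t + i] whose ball meets [[-1, n + 1]] has [-2 <= i <= n + 1]: there are [n + 4] of
   them, indexed from 0 after a shift by 2. The rest of the line has mass 0. *)
pose A i : set R := ball (t + i%:R - 2) r.
have mU : measurable (\big[setU/set0]_(i < n + 4) A i).
  by apply: bigsetU_measurable => i _; exact: measurable_ball.
have nuE (C : set R) : measurable C -> nu C = (fine (nu C))%:E.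
  by move=> mC; rewrite fineK// fin_num_measure.
set B := @to_torus R @^-1` ball (to_torus t) r.
have mB : measurable B by exact: measurable_preimage_torus_ball.
rewrite -[fine _]/(fine (nu B)) -lee_fin -nuE//.
apply: (@le_trans _ _ (nu ((\big[setU/set0]_(i < n + 4) A i)
    `|` outer 1))).
  apply: le_measure; rewrite ?inE.
  - exact: mB.
  - by apply: measurableU.
  move=> z /to_torus_ballP[i zi].
  have [z1|z1] := ltP z (- 1); first by right; left.
  have [z2|z2] := ltP (n%:R + 1) z; first by right; right.
  left; move: zi; rewrite -ball_normE/= => zi.
  have /andP[i1 i2] : (-3 < i < n%:Z + 2)%R.
    rewrite -!(ltr_int R) !rmorphD/= ?rmorphN/=.
    by move: zi; rewrite ltr_norml => /andP[? ?]; apply/andP; split; lra.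
  have [j ij] : exists j : nat, i + 2 = j%:Z by exists (absz (i + 2)%R); lia.
  have jn : (j < n + 4)%N by lia.
  rewrite -bigcup_mkord; exists j => //; rewrite /A -ball_normE/=.
  suff -> : t + j%:R - 2 = t + i%:~R by [].
  by rewrite -(addrK 2 i) ij rmorphB/= addrA.
apply: (le_trans (measureU2 _ _ _)) => //.
rewrite [X in (_ + X)%E]outer_mass0// adde0.
apply: (le_trans (Boole_inequality _ _)).
  by move=> i _; exact: measurable_ball.
apply: (@le_trans _ _ (\sum_(i < n + 4) c%:E)%E).
  apply: lee_sum => i _; have := yc (t + i%:R - 2).
  by rewrite -lee_fin /ball_mass -nuE//; exact: measurable_ball.
by rewrite sumEFin lee_fin sumr_const card_ord mulr_natl.
Qed.

End ball_mass.

(** * Masses of balls *)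

Section weights.
Context {R : realType}.

Lemma ler_bin_weight n i j :
  ('C(n, i) <= 'C(n, j))%N -> bin_weight n i <= bin_weight n j :> R.
Proof. by move=> ij; rewrite ler_pM2r ?invr_gt0 ?exprn_gt0// ler_nat. Qed.

Lemma bin_weight_gt0 n j : (j <= n)%N -> 0 < bin_weight n j :> R.
Proof. by move=> jn; rewrite divr_gt0 ?exprn_gt0// ltr0n bin_gt0. Qed.

Lemma bin_weight_le1 n j : bin_weight n j <= 1 :> R.
Proof.
rewrite ler_pdivrMr ?exprn_gt0// mul1r -natrX ler_nat.
elim: n j => [|n IH] [|j]; rewrite ?bin0 ?bin0n ?expn_gt0//.
by rewrite binS expnS mul2n -addnn leq_add.
Qed.

End weights.

(* [F y r] stands for the mass of [B(y, r)]. *)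
Section self_similar_function.
Context {R : realType}.
Variables (d k : nat) (F : R -> R -> R).
Local Notation n := (d + k)%N.
Local Notation p := (@bin_weight R n).
Local Notation P := (p n./2).
Hypothesis d_large : (5 * k + 20 <= d)%N.
Hypothesis F_ge0 : forall y r, 0 <= F y r.
Hypothesis F_le1 : forall y r, F y r <= 1.
Hypothesis F_rec : forall y r, F y r =
  \sum_(j < n.+1) p j * F (d%:R * y - j%:R * (d%:R - 1)) (d%:R * r).
Hypothesis F_outside : forall y r, y < - r \/ n%:R + r < y -> F y r = 0.
Hypothesis F_full : forall y r, 0 <= y <= n%:R -> n%:R < r -> F y r = 1.

Let d_ge : (5 * k%:R + 20 <= d%:R :> R).
Proof. by rewrite -natrM -natrD ler_nat. Qed.

Let k_ge0 : 0 <= k%:R :> R. Proof. by []. Qed.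

Let d1_gt0 : 0 < d%:R - 1 :> R.
Proof. by move: d_ge k_ge0 => h1 h2; lra. Qed.

Lemma max_weight_gt0 : 0 < P.
Proof. by apply: bin_weight_gt0; lia. Qed.

Lemma weight_le_max j : p j <= P.
Proof. by apply: ler_bin_weight; exact: leq_bin_half. Qed.

(** Such a weight is at most [p (k + 3)], and the single step to [p (k + 4)] already gains a factor
    4. *)
Lemma edge_weight j : (j <= n)%N -> (j <= k + 3)%N || (n <= j + (k + 3))%N ->
  4 * p j <= P.
Proof.
move=> jn jk; apply: (@le_trans _ _ (4 * p (k + 3))).
  rewrite ler_pM2l//; apply: ler_bin_weight; case/orP: jk => jk.
    by apply: leq_bin_inner; lia.
  by rewrite -bin_sub//; apply: leq_bin_inner; lia.
apply: (@le_trans _ _ (p (k + 3).+1)); last exact: weight_le_max.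
rewrite /bin_weight mulrA ler_pM2r ?invr_gt0 ?exprn_gt0// -natrM ler_nat.
by apply: bin_step4; lia.
Qed.

Let scale_radius (rho : R) N : d%:R * (rho / d%:R ^+ N.+1) = rho / d%:R ^+ N.
Proof. by rewrite exprS; field; rewrite ?expf_neq0 ?pnatr_eq0//; lia. Qed.

(* At each step at most two digits contribute. When two do, both next points
   lie near an end of [[0, n]], where only digits of weight at most [P / 4]
   are available; this is why the bound is halved there. *)
Lemma mass_upper N :
  (forall y, F y (2^-1 / d%:R ^+ N) <= 2 * P ^+ N) /\
  (forall y, y <= k%:R + 2 \/ d%:R - 2 <= y -> F y (2^-1 / d%:R ^+ N) <= P ^+ N).
Proof.
have dg := d_ge; have k0 := k_ge0; have d1 := d1_gt0.
elim: N => [|N [IH IHe]].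
  by split=> y; rewrite expr0 ?mulr1 ?(le_trans (F_le1 _ _))// ler1n.
set r := 2^-1 / d%:R ^+ N in IH IHe.
have dN : 1 <= d%:R ^+ N :> R by rewrite exprn_ege1// ler1n; lia.
have r1 : r <= 1.
  rewrite /r ler_pdivrMr ?mul1r; last exact: lt_le_trans dN.
  by apply: le_trans dN; lra.
pose nxt (y : R) (j : nat) := d%:R * y - j%:R * (d%:R - 1).
pose S y := [pred j : 'I_n.+1 | -1 <= nxt y j <= n%:R + 1].
have FS y : F y (2^-1 / d%:R ^+ N.+1) = \sum_(j in S y) p j * F (nxt y j) r.
  rewrite F_rec scale_radius -/r (bigID (mem (S y)))/= [X in _ + X]big1 ?addr0//.
  move=> j; rewrite inE negb_and -!ltNge => jS; rewrite F_outside ?mulr0//.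
  by case/orP: jS; rewrite /nxt => h; [left|right]; lra.
have P0 := max_weight_gt0; have PN0 : 0 <= P ^+ N by rewrite exprn_ge0// ltW.
(* Digits that differ by at least 2 send [y] to points at least [2 (d - 1)] apart, more than the
   length [n + 2] of [[-1, n + 1]]. *)
have gap y (i j : 'I_n.+1) : i \in S y -> j \in S y -> (i.+2 <= j)%N -> False.
  rewrite !inE /nxt natrD => /andP[_ iS] /andP[jS _].
  rewrite -(ler_nat R) -addn2 natrD => ij.
  have : (i%:R + 2) * (d%:R - 1) <= j%:R * (d%:R - 1) :> R.
    by rewrite ler_pM2r.

  by move=> h; lra.
have cardS y : (#|S y| <= 2)%N.
  rewrite leqNgt; apply/negP => /card_gt2P[a [b [c [[aS bS cS]]]]].
  rewrite -!val_eqE/= => -[ab bc ca].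
  have {ab bc ca} : [\/ (a.+2 <= b)%N, (b.+2 <= a)%N, (a.+2 <= c)%N |
    (c.+2 <= a)%N] \/ (b.+2 <= c)%N \/ (c.+2 <= b)%N.
    have [h|h] := boolP ((b.+2 <= c)%N || (c.+2 <= b)%N).
      by right; apply/orP.
    left; have [?|h1] := leqP a.+2 b; first exact: Or41.
    have [?|h2] := leqP b.+2 a; first exact: Or42.
    have [?|h3] := leqP a.+2 c; first exact: Or43.
    by apply: Or44; clear -ab bc ca h h1 h2 h3; lia.
  by move=> [[]|[]]; [exact: (gap y a b)|exact: (gap y b a)|exact: (gap y a c)|
    exact: (gap y c a)|exact: (gap y b c)|exact: (gap y c b)].
have sumS y c : 0 <= c -> (forall j, j \in S y -> p j * F (nxt y j) r <= c) ->
    F y (2^-1 / d%:R ^+ N.+1) <= c *+ #|S y|.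
  by move=> c0 hc; rewrite FS -sumr_const; apply: ler_sum => j /hc.
have PP0 : 0 <= P * P ^+ N by rewrite mulr_ge0// ltW.
split=> y.
  have [S1|S2] := leqP #|S y| 1.
    have X0 : 0 <= 2 * (P * P ^+ N) by rewrite mulr_ge0.
    rewrite [P ^+ N.+1]exprS (le_trans (sumS y _ X0 _))//; last exact: (ler_wpMn2l X0 S1).
    by move=> j _; rewrite mulrCA ler_pM ?bin_weight_ge0// weight_le_max.
  have S2' : #|S y| = 2 by apply/eqP; rewrite eqn_leq cardS.
  rewrite (le_trans (sumS y _ PP0 _))//; last first.
    by rewrite S2' [P ^+ N.+1]exprS mulr_natl.
  move=> j jS; rewrite ler_pM ?bin_weight_ge0 ?weight_le_max//; apply: IHe.
  have [i iS ij] : exists2 i, i \in S y & i != j.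
    have /card_gt1P[a [b [aS bS ab]]] := S2.
    have [aj|aj] := eqVneq a j; last by exists a.
    by exists b => //; rewrite -aj eq_sym.
  rewrite -val_eqE/= in ij.
  (* The two digits are consecutive, so the next points are [d - 1] apart within [[-1, n + 1]]: one
     is at most [k + 2], the other at least [d - 2]. *)
  have ji : (i = j.+1 :> nat) \/ (j = i.+1 :> nat).
    have [h|h] := ltnP j i; [left|right].
      have g := gap y j i jS iS; clear -h ij g; lia.
    have g := gap y i j iS jS; clear -h ij g; lia.
  move: iS jS; rewrite !inE /nxt natrD => /andP[i1 i2] /andP[j1 j2].
  case: ji => ji; [right; move: i1 i2|left; move: j1 j2];
    by rewrite ji -natr1 => h1 h2; lra.
(* Near an end, each of the at most two terms is bounded by [(P / 4) * (2 * P ^+ N)], half of the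
   target. *)
move=> ye; have X0 : 0 <= P * P ^+ N / 2 by rewrite divr_ge0.
rewrite [P ^+ N.+1]exprS (le_trans (sumS y _ X0 _))//; last first.
  by rewrite (le_trans (ler_wpMn2l X0 (cardS y)))// mulr2n; lra.
move=> j jS; have pj : 4 * p j <= P.
  apply: edge_weight; first by rewrite -ltnS.
  move: jS; rewrite !inE /nxt natrD => /andP[j1 j2].
  case: ye => ye; apply/orP; [left|right]; rewrite leqNgt -(ltr_nat R); apply/negP.
    rewrite ltr_nat -addn1 -addnA -(ler_nat R) natrD => h.
    have : (k%:R + 4) * (d%:R - 1) <= j%:R * (d%:R - 1) :> R by rewrite ler_pM2r.
    have : d%:R * y <= d%:R * (k%:R + 2) by rewrite ler_wpM2l.
    by move=> h1 h2; lra.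
  rewrite ltr_nat addnA addnC => h.
  have {}h : (j + 4 <= d)%N by clear -h; lia.
  move: h; rewrite -(ler_nat R) natrD => h.
  have : j%:R * (d%:R - 1) <= (d%:R - 4) * (d%:R - 1) :> R.
    by rewrite ler_pM2r//; lra.
  have : d%:R * (d%:R - 2) <= d%:R * y by rewrite ler_wpM2l.
  by move=> h1 h2; lra.
have h1 : F (nxt y j) r <= 2 * P ^+ N := IH _.
have h2 : p j <= P / 4 by lra.
rewrite (le_trans (ler_pM (bin_weight_ge0 _ _) (F_ge0 _ _) h2 h1))//; lra.
Qed.

Lemma mass_ge_digit j y r : (j <= n)%N ->
  p j * F (d%:R * y - j%:R * (d%:R - 1)) (d%:R * r) <= F y r.
Proof.
move=> jn; rewrite [leRHS]F_rec.
rewrite (bigD1 (Ordinal (jn : j < n.+1)%N))//= lerDl sumr_ge0// => i _.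
by rewrite mulr_ge0 ?bin_weight_ge0.
Qed.

(* With [b = floor (d x)], the digit [m] or [m + 1] sends [x + m] to
   [(d x - b) + ((m + b) mod (d - 1))]: modulo [d - 1], the integer parts are
   permuted, so the product over all of them is multiplicative. *)
Lemma mass_product_lower N x : 0 <= x < 1 ->
  (\prod_(m < d.-1) Num.min (p m) (p m.+1)) ^+ N <=
  \prod_(m < d.-1) F (x + m%:R) (n.+1%:R / d%:R ^+ N).
Proof.
have dg := d_ge; have k0 := k_ge0.
elim: N x => [|N IH] x /andP[x0 x1].
  rewrite expr0 expr0 divr1 big1 ?lexx// => m _; apply: F_full.
    apply/andP; split; first by rewrite addr_ge0.
    have : m%:R + 1 <= n%:R :> R.
      by rewrite natr1 ler_nat; have := ltn_ord m; lia.
    by move=> h; lra.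
  by rewrite ltr_nat.
pose b := Num.truncn (d%:R * x).
have /andP[bl bu] : b%:R <= d%:R * x < b.+1%:R by rewrite truncn_itv// mulr_ge0.
have bd : (b < d)%N.
  rewrite -(ltr_nat R) (le_lt_trans bl)// -[ltRHS]mulr1 ltr_pM2l//; lra.
have x'1 : 0 <= d%:R * x - b%:R < 1.
  by apply/andP; split; [lra|rewrite -natr1 in bu; lra].
have {IH} := IH _ x'1; case e_def : d.-1 => [|e].
  by rewrite !big_ord0 expr1n.
have de : d%:R = e%:R + 2 :> R by rewrite -natrD; congr _%:R; clear -e_def; lia.
(* Here [e.+1 = d - 1]; translation by [b] in the cyclic group ['I_e.+1] permutes the factors of the
   induction hypothesis. *)
rewrite [leRHS](reindex_inj (addIr (inZp b : 'I_e.+1)))/= => IH.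
rewrite exprS; apply: (@le_trans _ _ (\prod_(m < e.+1) (Num.min (p m) (p m.+1)) *
    \prod_(m < e.+1) F (d%:R * x - b%:R + ((m + inZp b)%R : 'I_e.+1)%:R)
      (n.+1%:R / d%:R ^+ N))).
  rewrite ler_wpM2l// prodr_ge0// => m _.
  by rewrite le_min !bin_weight_ge0.
rewrite -big_split/=; apply: ler_prod => m _.
rewrite mulr_ge0 ?le_min ?bin_weight_ge0//=.
have me := ltn_ord m.
have [a an [wa ya]] : exists2 a, (a <= n)%N & Num.min (p m) (p m.+1) <= p a /\
    d%:R * (x + m%:R) - a%:R * (d%:R - 1) =
    d%:R * x - b%:R + ((m + b) %% e.+1)%:R.
  (* As [m + b < 2 (d - 1)], reduction modulo [d - 1] subtracts [d - 1] at most once; taking digit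
     [m.+1] instead of [m] performs this subtraction. *)
  have [mb|mb] := ltnP (m + b) e.+1.
    exists m; first by clear -e_def me; lia.
    split; first by rewrite ge_min lexx.
    by rewrite modn_small// natrD; ring.
  exists m.+1; first by clear -e_def me; lia.
  split; first by rewrite ge_min lexx orbT.
  have -> : ((m + b) %% e.+1)%N = (m + b - e.+1)%N.
    rewrite -{1}(subnK mb) modnDr modn_small//; clear -e_def me bd; lia.
  by rewrite natrB// natrD de -!natr1; ring.
rewrite modnDmr (le_trans _ (mass_ge_digit _ _ an))// scale_radius ya.
by rewrite ler_wpM2r.
Qed.

(* Any other first digit moves the next point by a multiple of [d - 1], out of
   [[0, n]]. *)
Lemma mass_unique_digit s y r : (s <= n)%N ->
  k%:R + 2 <= d%:R * y - s%:R * (d%:R - 1) <= n./2%:R -> d%:R * r <= 2^-1 ->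
  F y r = p s * F (d%:R * y - s%:R * (d%:R - 1)) (d%:R * r).
Proof.
have dg := d_ge; have k0 := k_ge0; have d1 := d1_gt0.
move=> sn /andP[z1 z2] r2; rewrite [LHS]F_rec.
rewrite (bigD1 (Ordinal (sn : s < n.+1)%N))//= [X in _ + X]big1 ?addr0// => j.
rewrite -val_eqE/= => js; rewrite F_outside ?mulr0//.
(* A larger digit gives a next point at most [n/2 - (d - 1) < -1/2]. A smaller one gives at least
   [(k + 2) + (d - 1) = n + 1 > n + 1/2], which is where the bound [k + 2] matters. *)
have h2 : 2 * n./2%:R <= d%:R + k%:R :> R by rewrite -natrM -natrD ler_nat; lia.
have {js} [js|js] : (s.+1 <= j)%N \/ (j.+1 <= s)%N by lia.
  left; have : (s%:R + 1) * (d%:R - 1) <= j%:R * (d%:R - 1) :> R.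
    by rewrite ler_pM2r// natr1 ler_nat.
  by move=> h; lra.
right; have : (j%:R + 1) * (d%:R - 1) <= s%:R * (d%:R - 1) :> R.
  by rewrite ler_pM2r// natr1 ler_nat.
by rewrite natrD => h; lra.
Qed.

(** The point is the sum of [s i * (d - 1) / d ^ (i + 1)]. Its successive images stay in
    [[k + 2, n/2]], so the prescribed digit is the only contributing one at every step, which gives
    the upper bound; the lower bound keeps just that digit. *)
Lemma point_with_digits (s : nat -> nat) :
  (forall i, (k.+2 <= s i <= n./2)%N) ->
  exists2 y, k%:R + 2 <= y <= n./2%:R & forall N,
    \prod_(i < N) p (s i) <= F y (n.+1%:R / d%:R ^+ N) /\
    F y (2^-1 / d%:R ^+ N) <= \prod_(i < N) p (s i).
Proof.
have dg := d_ge; have k0 := k_ge0; have d1 := d1_gt0.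
move=> hs.
have sn i : (s i <= n)%N by have := hs i; lia.
have sl i : k%:R + 2 <= (s i)%:R :> R.
  by rewrite -natrD ler_nat addn2; case/andP: (hs i).
have su i : (s i)%:R <= n./2%:R :> R by rewrite ler_nat; case/andP: (hs i).
have d0 : 0 < d%:R :> R by lra.
have dN0 N : 0 < d%:R ^+ N :> R by rewrite exprn_gt0.
pose u N : R := \sum_(i < N) (s i)%:R * (d%:R - 1) / d%:R ^+ i.+1.
(* [v N] and [w N] complete the partial sum [u N] by the tails with constant digit [k + 2] and
   [n./2], the extreme ones allowed. *)
pose v N : R := u N + (k%:R + 2) / d%:R ^+ N.
pose w N : R := u N + n./2%:R / d%:R ^+ N.
have uS N : u N.+1 = u N + (s N)%:R * (d%:R - 1) / d%:R ^+ N.+1.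
  by rewrite /u big_ord_recr.
have expS N (c : R) : c / d%:R ^+ N = c * d%:R / d%:R ^+ N.+1.
  by rewrite exprS; field; rewrite !gt_eqF.
have v_nd : nondecreasing_seq v.
  apply/nondecreasing_seqP => N; rewrite /v uS -addrA lerD2l expS -mulrDl.
  by rewrite ler_pM2r ?invr_gt0//; have := ler_wpM2r (ltW d1) (sl N); lra.
have w_ni : nonincreasing_seq w.
  apply/nonincreasing_seqP => N; rewrite /w uS -addrA lerD2l (expS N) -mulrDl.
  by rewrite ler_pM2r ?invr_gt0//; have := ler_wpM2r (ltW d1) (su N); lra.
have vw i j : v i <= w j.
  have vwi l : v l <= w l.
    by rewrite lerD2l ler_pM2r ?invr_gt0// (le_trans (sl 0%N)).
  have [ij|ji] := leqP i j.
    by apply: le_trans (vwi j); exact: v_nd.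
  by apply: le_trans (vwi i) _; exact: w_ni (ltnW ji).
have v_sup : has_sup (range v).
  by split; [exists (v 0%N); exists 0%N|exists (w 0%N) => _ [i _ <-]; exact: vw].
pose y := sup (range v).
have vy N : v N <= y by apply: ub_le_sup; [exact: v_sup.2|exists N].
have yw N : y <= w N by apply: ge_sup; [exact: v_sup.1|move=> _ [i _ <-]; exact: vw].
(* The image of [y] after its first [N] digits are removed. *)
pose z N := d%:R ^+ N * (y - u N).
have zS N : z N.+1 = d%:R * z N - (s N)%:R * (d%:R - 1).
  by rewrite /z uS exprS; field; rewrite !gt_eqF.
have zb N : k%:R + 2 <= z N <= n./2%:R.
  have h1 : (k%:R + 2) / d%:R ^+ N <= y - u N by have := vy N; rewrite /v; lra.
  have h2 : y - u N <= n./2%:R / d%:R ^+ N by have := yw N; rewrite /w; lra.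
  rewrite /z [_ * (y - _)]mulrC; apply/andP; split.
    by rewrite -ler_pdivrMr.
  by rewrite -ler_pdivlMr.
have z0 : z 0%N = y by rewrite /z expr0 mul1r /u big_ord0 subr0.
exists y; first by rewrite -z0.
move=> N; split.
  suff H rho : \prod_(i < N) p (s i) * F (z N) rho <= F y (rho / d%:R ^+ N).
    apply: le_trans (H _); rewrite (@F_full (z N)) ?mulr1 ?ltr_nat//.
    have /andP[h1 h2] := zb N; apply/andP; split; first lra.
    by apply: (le_trans h2); rewrite ler_nat; lia.
  elim: N rho => [|N IH] rho.
    by rewrite big_ord0 mul1r expr0 divr1 z0.
  apply: (@le_trans _ _ (\prod_(i < N) p (s i) * F (z N) (rho / d%:R))).
    rewrite big_ord_recr/= -mulrA ler_wpM2l ?prodr_ge0// => [i _|].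
      exact: bin_weight_ge0.
    have := mass_ge_digit (z N) (rho / d%:R) (sn N); rewrite -zS.
    by rewrite mulrCA divff ?mulr1// gt_eqF.
  by rewrite (le_trans (IH _))// exprS invfM mulrA.
suff H rho : rho <= 2^-1 ->
    F y (rho / d%:R ^+ N) <= \prod_(i < N) p (s i) * F (z N) rho.
  rewrite (le_trans (H _ _))// ler_piMr ?F_le1// prodr_ge0// => i _.
  exact: bin_weight_ge0.
elim: N rho => [|N IH] rho rho2.
  by rewrite big_ord0 mul1r expr0 divr1 z0.
have rd : rho / d%:R <= 2^-1.
  by rewrite ler_pdivrMr// (le_trans rho2)// ler_peMr//; lra.
rewrite exprS invfM mulrA (le_trans (IH _ rd))// big_ord_recr/= -mulrA.
rewrite ler_wpM2l ?prodr_ge0// => [i _|]; first exact: bin_weight_ge0.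
have dr : d%:R * (rho / d%:R) = rho by rewrite mulrCA divff ?mulr1// gt_eqF.
have zd : k%:R + 2 <= d%:R * z N - (s N)%:R * (d%:R - 1) <= n./2%:R.
  by rewrite -zS; exact: zb.
by rewrite (mass_unique_digit (sn N) zd) dr// -zS.
Qed.

End self_similar_function.

(** * Logarithmic ratios *)

Section log_ratio.
Context {R : realType}.
Implicit Types (f phi : R -> R) (a b l C rho D r : R).

Lemma near0_ln_small C e : 0 < e ->
  \forall r \near 0^'+, [/\ 0 < r, ln r < 0 & `|C / ln r| < e].
Proof.
move=> e0; near=> r.
have r0 : 0 < r by near: r; exact: nbhs_right_gt.
have t0 : 0 < (`|C| + 1) / e by rewrite divr_gt0// ltr_wpDl.
have lr : ln r < - ((`|C| + 1) / e).
  rewrite -[ltRHS]expRK ltr_ln ?posrE ?expR_gt0//.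
  by near: r; apply: nbhs_right_lt; exact: expR_gt0.
have lr0 : ln r < 0 by rewrite (lt_trans lr)// oppr_lt0.
split=> //; rewrite normrM normfV (ltr0_norm lr0) ltr_pdivrMr ?oppr_gt0//.
rewrite -ltr_pdivrMl// mulrC ltrNr (lt_trans lr)// ltrN2 ltr_pM2r ?invr_gt0//.
by rewrite ltrDl.
Unshelve. all: by end_near.
Qed.

Lemma cvg_log_ratio f l C rho : 0 < rho ->
  (forall r, 0 < r < rho -> `|f r - l * ln r| <= C) ->
  f r / ln r @[r --> 0^'+] --> l.
Proof.
move=> rho0 fl; apply/cvgrPdist_lt => e e0; near=> r.
have [r0 lr0 Ce] : [/\ 0 < r, ln r < 0 & `|C / ln r| < e].
  by near: r; exact: near0_ln_small.
rewrite (le_lt_trans _ Ce)// distrC.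
have -> : f r / ln r - l = (f r - l * ln r) / ln r.
  by rewrite mulrBl mulfK// lt_eqF.
rewrite !normrM ler_wpM2r// (le_trans (fl r _) (ler_norm _))// r0/=.
by near: r; exact: nbhs_right_lt.
Unshelve. all: by end_near.
Qed.

Lemma log_ratio_ge f l a C rho : 0 < rho ->
  f r / ln r @[r --> 0^'+] --> l ->
  (forall r, 0 < r < rho -> f r <= C + a * ln r) -> a <= l.
Proof.
move=> rho0 /cvgrPdist_lt fl fa; apply/ler_addgt0Pr => e e0.
have e2 : 0 < e / 2 by lra.
near (0 : R)^'+ => r.
have [r0 lr0 Ce] : [/\ 0 < r, ln r < 0 & `|C / ln r| < e / 2].
  by near: r; exact: near0_ln_small.
have h1 : `|l - f r / ln r| < e / 2 by near: r; exact: fl.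
have h2 : a + C / ln r <= f r / ln r.
  rewrite ler_ndivlMr// mulrDl divfK ?lt_eqF// addrC; apply: fa.
  by rewrite r0/=; near: r; exact: nbhs_right_lt.
by move: h1 Ce; rewrite !ltr_norml => /andP[h3 h4] /andP[h5 h6]; lra.
Unshelve. all: by end_near.
Qed.

Lemma log_ratio_le f l b C rho : 0 < rho ->
  f r / ln r @[r --> 0^'+] --> l ->
  (forall r, 0 < r < rho -> - C + b * ln r <= f r) -> l <= b.
Proof.
move=> rho0 fl fb; rewrite -lerN2.
apply: (@log_ratio_ge (fun r => - f r) (- l) (- b) C rho) => //.
  by rewrite [X in X @ _](_ : _ = fun r => - (f r / ln r));
    [exact: cvgN|apply/funext => r; rewrite mulNr].
by move=> r /fb; lra.
Qed.

(** The witness is the integer part of [(ln rho - ln r) / ln D]; the logarithmic form of the bounds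
    later trades [N] for [ln r]. *)
Lemma log_scale D rho r : 1 < D -> 0 < r < rho -> exists N,
  [/\ r <= rho / D ^+ N, rho / D ^+ N.+1 <= r &
      N%:R * ln D <= ln rho - ln r <= N.+1%:R * ln D].
Proof.
move=> D1 /andP[r0 rrho]; have rho0 := lt_trans r0 rrho.
have lD : 0 < ln D by rewrite ln_gt0.
have D0 : 0 < D by exact: lt_trans D1.
have lrr : 0 <= (ln rho - ln r) / ln D.
  by rewrite divr_ge0 ?subr_ge0 ?ler_ln ?posrE// ltW.
exists (Num.truncn ((ln rho - ln r) / ln D)).
set N := Num.truncn _.
have /andP[] := truncn_itv lrr.
rewrite -/N ler_pdivlMr// ltr_pdivrMr// => h1 h2.
split; last by rewrite h1 ltW.
- rewrite ler_pdivlMr ?exprn_gt0// -ler_ln ?posrE ?mulr_gt0 ?exprn_gt0//.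
  by rewrite lnM ?posrE ?exprn_gt0// lnXn// -mulr_natl; lra.
- rewrite ler_pdivrMr ?exprn_gt0// -ler_ln ?posrE ?mulr_gt0 ?exprn_gt0//.
  by rewrite lnM ?posrE ?exprn_gt0// lnXn// -[ln D *+ _]mulr_natl; lra.
Qed.

(** By monotonicity, a bound along the radii [rho / D ^+ N] extends to all small radii at the cost
    of [a * ln D] in the constant. *)
Lemma geometric_ln_upper phi D rho a C : 1 < D -> 0 <= a ->
  (forall r, 0 < r -> 0 < phi r) ->
  (forall r s, r <= s -> phi r <= phi s) ->
  (forall N, ln (phi (rho / D ^+ N)) <= C - a * (N%:R * ln D)) ->
  forall r, 0 < r < rho ->
  ln (phi r) <= C + a * ln D - a * ln rho + a * ln r.
Proof.
move=> D1 a0 phi0 phi_le H r rr; have [N [rN _ /andP[_ hN]]] := log_scale D1 rr.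
have /andP[r0 _] := rr.
apply: (@le_trans _ _ (ln (phi (rho / D ^+ N)))).
  by rewrite ler_ln ?posrE ?phi0 ?phi_le// (lt_le_trans r0).
apply: (le_trans (H N)); rewrite -natr1 in hN.
by have := ler_wpM2l a0 hN; lra.
Qed.

Lemma geometric_ln_lower phi D rho b C : 1 < D -> 0 <= b -> 0 < rho ->
  (forall r, 0 < r -> 0 < phi r) ->
  (forall r s, r <= s -> phi r <= phi s) ->
  (forall N, - C - b * (N%:R * ln D) <= ln (phi (rho / D ^+ N))) ->
  forall r, 0 < r < rho ->
  - (C + b * ln rho + b * ln D) + b * ln r <= ln (phi r).
Proof.
move=> D1 b0 rho0 phi0 phi_le H r rr.
have [N [_ rN /andP[hN _]]] := log_scale D1 rr.
have /andP[r0 _] := rr.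
apply: (@le_trans _ _ (ln (phi (rho / D ^+ N.+1)))); last first.
  rewrite ler_ln ?posrE ?phi0 ?phi_le// divr_gt0// exprn_gt0//.
  exact: lt_trans D1.
apply: le_trans (H N.+1); rewrite -natr1.
by have := ler_wpM2l b0 hN; lra.
Qed.

End log_ratio.

(** * Local dimensions *)

Section local_dimensions.
Context {R : realType}.
Variables (d k : nat) (m : probability R R).
Local Notation n := (d + k)%N.
Local Notation p := (@bin_weight R n).
Local Notation P := (p n./2).
Local Notation Q := (p k.+2).
Local Notation nu := (convolution_pow m n).
Local Notation nu_pi := (torus_quotient_measure nu).
Local Notation F := (ball_mass n m).
Local Notation W := (\prod_(j < d.-1) Num.min (p j) (p j.+1)).
Hypotheses (d_large : (5 * k + 20 <= d)%N) (m_cantor : is_cantor_measure d m).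
Hypothesis Q_lt_W : Q ^+ d.-1 < W.

Lemma d_gt1 : (1 < d)%N. Proof. by lia. Qed.

Lemma weight_index_le_half : (k.+2 <= n./2)%N. Proof. by clear -d_large; lia. Qed.

Lemma ln_d_gt0 : 0 < ln d%:R :> R.
Proof. by rewrite ln_gt0// ltr1n; exact: d_gt1. Qed.

Let Q_gt0 : 0 < Q. Proof. by apply: bin_weight_gt0; lia. Qed.

Let P_gt0 : 0 < P. Proof. by apply: bin_weight_gt0; lia. Qed.

Let Q_lt_P : Q < P.
Proof.
have q0 := Q_gt0; have : 4 * Q <= P by apply: edge_weight => //; lia.
by lra.
Qed.

Let W_gt0 : 0 < W.
Proof. by apply: lt_trans Q_lt_W; rewrite exprn_gt0. Qed.

Let W_le1 : W <= 1.
Proof.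
rewrite -[leRHS](expr1n _ d.-1) -[d.-1 in leRHS]card_ord -prodr_const.
by apply: ler_prod => j _; rewrite le_min !bin_weight_ge0 ge_min bin_weight_le1.
Qed.

(** Each of the [d - 1] balls around [t + j] projects into the same torus ball, so every factor of
    the product bound is at most its mass. *)
Lemma torus_mass_product t N : 0 <= t < 1 ->
  W ^+ N <= fine (nu_pi (ball (to_torus t) (n.+1%:R / d%:R ^+ N))) ^+ d.-1.
Proof.
move=> t01.
apply: le_trans (mass_product_lower d_large (ball_mass_ge0 n m)
  (ball_mass_rec n d_gt1 m_cantor) (ball_mass_full d_gt1 m_cantor) N t01) _.
rewrite -[d.-1 in leRHS]card_ord -prodr_const; apply: ler_prod => j _.
by rewrite ball_mass_ge0/= (le_trans _ (torus_mass_ge _ _ _ _ j%:Z)).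
Qed.

Lemma torus_mass_gt0 (x : torus R) r : 0 < r -> 0 < fine (nu_pi (ball x r)).
Proof.
have [t t01 ->] := to_torus_surj x; move=> r0.
have [N Nr] : exists N, n.+1%:R / d%:R ^+ N <= r.
  have [rn|nr] := ltP r n.+1%:R; last by exists 0%N; rewrite expr0 divr1.
  have d1 : 1 < d%:R :> R by rewrite ltr1n d_gt1.
  have rr : 0 < r < n.+1%:R by rewrite r0.
  by have [N [_ ? _]] := log_scale d1 rr; exists N.+1.
apply: lt_le_trans (le_torus_mass _ _ _ Nr).
rewrite lt_neqAle fine_ge0// andbT eq_sym; apply: contraTneq (torus_mass_product N t01) => ->.
have dp : (0 < d.-1)%N by rewrite -subn1 subn_gt0; exact: d_gt1.
by rewrite expr0n -ltNge gtn_eqF// exprn_gt0.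
Qed.

(** The left bound comes from the uniform estimate [2 * P ^+ N] on balls of the line. For the right
    one, the mass is at least [W] to the power [N / (d - 1)], and [Q_lt_W] makes the resulting
    inequality strict. *)
Lemma torus_local_dim_bounds (x : torus R) (l : R) : is_local_dim nu_pi x l ->
  - ln P <= l * ln d%:R < - ln Q.
Proof.
have ld := ln_d_gt0.
have d1 : 1 < d%:R :> R by rewrite ltr1n d_gt1.
have pos := torus_mass_gt0 x.
have mono := le_torus_mass n m x.
have [t t01 xt] := to_torus_surj x; move=> xl.
apply/andP; split.
  rewrite -ler_pdivrMr//.
  have a0 : 0 <= - ln P / ln d%:R.
    by rewrite divr_ge0 ?(ltW ld)// oppr_ge0 ln_le0// bin_weight_le1.
  have H N : ln (fine (nu_pi (ball x (2^-1 / d%:R ^+ N)))) <=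
      ln ((n + 4)%:R * 2) - - ln P / ln d%:R * (N%:R * ln d%:R).
    have dN : 1 <= d%:R ^+ N :> R by rewrite exprn_ege1// ltW.
    have r0 : 0 < 2^-1 / d%:R ^+ N :> R.
      by rewrite divr_gt0// (lt_le_trans _ dN).
    have r1 : 2^-1 / d%:R ^+ N <= 1 :> R.
      by rewrite ler_pdivrMr ?mul1r; [apply: le_trans dN; lra|exact: lt_le_trans dN].
    have up := mass_upper d_large (ball_mass_ge0 n m) (@ball_mass_le1 _ n m)
      (ball_mass_rec n d_gt1 m_cantor) (fun y r => @ball_mass_outside _ _ _ _ d_gt1 m_cantor y r) N.
    have := torus_mass_le d_gt1 m_cantor t01 r1 up.1; rewrite -xt => le.
    have PN : 0 < P ^+ N by rewrite exprn_gt0.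
    have C0 : 0 < (n + 4)%:R * 2 :> R by rewrite mulr_gt0// ltr0n addn_gt0 orbT.
    have -> : ln ((n + 4)%:R * 2) - - ln P / ln d%:R * (N%:R * ln d%:R) =
        ln ((n + 4)%:R * (2 * P ^+ N)).
      rewrite mulrA [RHS]lnM ?posrE//.
      by rewrite lnXn// -[ln P *+ N]mulr_natr; field; rewrite gt_eqF.
    rewrite ler_ln ?posrE//; first exact: pos.
    by rewrite mulrA mulr_gt0.
  apply: (log_ratio_ge _ xl (geometric_ln_upper d1 a0 pos mono H)).
  by [].
set b := - (ln W / d.-1%:R) / ln d%:R.
have D0 : 0 < d.-1%:R :> R by rewrite ltr0n -subn1 subn_gt0; exact: d_gt1.
have b0 : 0 <= b.
  by rewrite /b divr_ge0 ?(ltW ld)// oppr_ge0 pmulr_lle0 ?invr_gt0// ln_le0.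
have H N : - 0 - b * (N%:R * ln d%:R) <=
    ln (fine (nu_pi (ball x (n.+1%:R / d%:R ^+ N)))).
  have := torus_mass_product N t01; rewrite -xt.
  set f := fine _ => Wf.
  have f0 : 0 < f by apply: pos; rewrite divr_gt0// exprn_gt0// (lt_trans _ d1).
  have {}Wf : N%:R * ln W <= d.-1%:R * ln f.
    rewrite !mulr_natl -!lnXn; [|exact: f0|exact: W_gt0].
    by rewrite ler_ln ?posrE; [exact: Wf|exact: exprn_gt0..].
  rewrite -(ler_pM2l D0) (le_trans _ Wf)// /b le_eqVlt; apply/orP; left.
  have cancel (w c L s : R) : c != 0 -> L != 0 ->
      c * (- 0 - - (w / c) / L * (s * L)) = s * w.
    by move=> c0 L0; field; rewrite ?c0 ?L0.
  by rewrite cancel ?eqxx ?gt_eqF.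
have lb : l <= b.
  have n0 : 0 < n.+1%:R :> R by [].
  exact: (log_ratio_le n0 xl (geometric_ln_lower d1 b0 n0 pos mono H)).
apply: (@le_lt_trans _ _ (b * ln d%:R)); first by rewrite ler_pM2r.
rewrite /b divfK ?gt_eqF// ltrN2 ltr_pdivlMr// mulr_natr -lnXn//.
by rewrite ltr_ln ?posrE ?exprn_gt0.
Qed.

(** Digit [n./2] is used exactly when the integer part of [N * theta] increases, so it occurs [c N]
    times among the first [N] digits; the rounding error below 1 costs at most [ln P - ln Q]. *)
Lemma floor_digits (theta : R) : 0 <= theta <= 1 -> exists s : nat -> nat,
  (forall i, s i = n./2 \/ s i = k.+2) /\
  forall N, N%:R * (theta * ln P + (1 - theta) * ln Q) - (ln P - ln Q) <=
    ln (\prod_(i < N) p (s i)) <= N%:R * (theta * ln P + (1 - theta) * ln Q).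
Proof.
move=> /andP[th0 th1].
pose c N := Num.truncn (N%:R * theta).
have cN N : (c N)%:R <= N%:R * theta < (c N)%:R + 1.
  by rewrite natr1 truncn_itv// mulr_ge0.
have c_le N : (c N <= c N.+1)%N.
  by apply: le_truncn; rewrite ler_wpM2r// ler_nat.
have c_step N : (c N.+1 <= (c N).+1)%N.
  rewrite -ltnS -(ltr_nat R) -!natr1.
  have /andP[h1 _] := cN N.+1; have /andP[_ h2] := cN N.
  by rewrite -natr1 mulrDl mul1r in h1; lra.
have c0 : c 0%N = 0%N by rewrite /c mul0r truncn0.
exists (fun i => if (c i < c i.+1)%N then n./2 else k.+2); split.
  by move=> i; case: ifP => _; [left|right].
move=> N.
have -> : ln (\prod_(i < N) p (if (c i < c i.+1)%N then n./2 else k.+2)) =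
    (c N)%:R * ln P + (N%:R - (c N)%:R) * ln Q.
  elim: N => [|N IH]; first by rewrite big_ord0 ln1 c0 !mul0r subrr mul0r addr0.
  rewrite big_ord_recr/= lnM ?posrE; last 2 first.
  - by apply: prodr_gt0 => i _; case: ifP.
  - by case: ifP.
  rewrite IH; case: ifPn => h.
    have -> : c N.+1 = (c N).+1 by apply/eqP; rewrite eqn_leq c_step.
    by rewrite -!natr1; ring.
  have -> : c N.+1 = c N by apply/eqP; rewrite eqn_leq c_le andbT leqNgt.
  by rewrite -!natr1; ring.
have PQ : 0 <= ln P - ln Q by rewrite subr_ge0 ler_ln ?posrE// ltW.
have /andP[h1 h2] := cN N.
have e1 : 0 <= N%:R * theta - (c N)%:R by lra.
have e2 : 0 <= 1 - (N%:R * theta - (c N)%:R) by lra.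
by have := mulr_ge0 e1 PQ; have := mulr_ge0 e2 PQ => g1 g2; apply/andP; split; lra.
Qed.

Lemma local_dim_attained (l : R) : - ln P <= l * ln d%:R <= - ln Q ->
  local_dims nu (measure_support nu `\` [set 0; n%:R]) l.
Proof.
move=> /andP[l1 l2]; have ld := ln_d_gt0.
have d1 : 1 < d%:R :> R by rewrite ltr1n d_gt1.
have PQ : 0 < ln P - ln Q by rewrite subr_gt0 ltr_ln ?posrE.
(* The frequency of the digit [n./2] for which the mean of [ln (p (s i))] is [- (l * ln d)]. *)
pose theta := (- ln Q - l * ln d%:R) / (ln P - ln Q).
have th : 0 <= theta <= 1.
  by rewrite /theta ler_pdivrMr// divr_ge0 ?(ltW PQ)//; lra.
have thl : theta * ln P + (1 - theta) * ln Q = - (l * ln d%:R).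
  by rewrite /theta; field; rewrite gt_eqF.
have [s [hs sprod]] := floor_digits th; rewrite thl in sprod.
have s_range i : (k.+2 <= s i <= n./2)%N.
  by case: (hs i) => ->; rewrite leqnn ?andbT weight_index_le_half.
have [y /andP[y1 y2] ymass] := point_with_digits d_large (ball_mass_ge0 n m)
  (@ball_mass_le1 _ n m) (ball_mass_rec n d_gt1 m_cantor)
  (fun y r => @ball_mass_outside _ _ _ _ d_gt1 m_cantor y r)
  (ball_mass_full d_gt1 m_cantor) s_range.
have prod0 N : 0 < \prod_(i < N) p (s i).
  apply: prodr_gt0 => i _; apply: bin_weight_gt0.
  by have := s_range i; clear; lia.
have mono := @le_ball_mass _ n m y.
have pos r : 0 < r -> 0 < F y r.
  move=> r0.
  have [N Nr] : exists N, n.+1%:R / d%:R ^+ N <= r.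
    have [rn|nr] := ltP r n.+1%:R; last by exists 0%N; rewrite expr0 divr1.
    have rr : 0 < r < n.+1%:R by rewrite r0.
    by have [N [_ ? _]] := log_scale d1 rr; exists N.+1.
  by apply: lt_le_trans (mono _ _ Nr); apply: lt_le_trans (ymass N).1.
have l0 : 0 <= l.
  rewrite -(pmulr_lge0 _ ld) (le_trans _ l1)// oppr_ge0 ln_le0//.
  exact: bin_weight_le1.
exists y.
  split.
    move=> U oU Uy.
    have /nbhs_ballP[e /= e0 eU] : nbhs y U by exact: open_nbhs_nbhs.
    apply: (@lt_le_trans _ _ (nu (ball y e))); last first.
      apply: le_measure; rewrite ?inE//; first exact: measurable_ball.
      exact: open_measurable.
    have := pos _ e0; rewrite -lte_fin fineK// fin_num_measure//.
    exact: measurable_ball.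
  have k0 : 0 <= k%:R :> R by [].
  move=> [] /= yE; first by rewrite yE in y1; lra.
  by move: y2; rewrite yE ler_nat; clear -d_large; lia.
have n0 : 0 < n.+1%:R :> R by [].
have half0 : 0 < 2^-1 :> R by [].
have upper := geometric_ln_upper d1 l0 pos mono.
have lower := geometric_ln_lower d1 l0 n0 pos mono.
have {}upper := upper 2^-1 0.
have {}lower := lower (ln P - ln Q).
have {}upper : forall r, 0 < r < 2^-1 -> ln (F y r) <=
    0 + l * ln d%:R - l * ln 2^-1 + l * ln r.
  apply: upper => N; have /andP[_ h] := sprod N.
  rewrite sub0r -mulrN [X in _ <= X](_ : _ = N%:R * - (l * ln d%:R)); last by ring.
  apply: le_trans h; rewrite ler_ln ?posrE//; first exact: (ymass N).2.
  by apply: pos; rewrite divr_gt0// exprn_gt0// (lt_trans _ d1).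
have {}lower : forall r, 0 < r < n.+1%:R ->
    - (ln P - ln Q + l * ln n.+1%:R + l * ln d%:R) + l * ln r <= ln (F y r).
  apply: lower => N; have /andP[h _] := sprod N.
  rewrite [X in X <= _](_ : _ = N%:R * - (l * ln d%:R) - (ln P - ln Q)); last by ring.
  apply: (le_trans h); rewrite ler_ln ?posrE//; first exact: (ymass N).1.
  by apply: pos; rewrite divr_gt0// exprn_gt0// (lt_trans _ d1).
(* The sum of the absolute values of both one-sided constants bounds the error on either side. *)
apply: (@cvg_log_ratio _ _ l (`|ln P - ln Q + l * ln n.+1%:R + l * ln d%:R| +
  `|0 + l * ln d%:R - l * ln 2^-1|) 2^-1) => // r /andP[r0 r2].
have h1 : ln (F y r) <= 0 + l * ln d%:R - l * ln 2^-1 + l * ln r.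
  by apply: upper; rewrite r0.
have h2 : - (ln P - ln Q + l * ln n.+1%:R + l * ln d%:R) + l * ln r <= ln (F y r).
  apply: lower; rewrite r0 (lt_le_trans r2)//.
  by rewrite (@le_trans _ _ 1) ?ler1n//; lra.
move: h1 h2; rewrite -[fine _]/(F y r).
set A := ln P - ln Q + _ + _; set B := _ - _; set lF := ln (F y r) => h1 h2.
have := ler_norm A; have := ler_norm B.
have := normr_ge0 A; have := normr_ge0 B.
by rewrite ler_norml => *; apply/andP; split; lra.
Qed.

End local_dimensions.

Theorem proposition4p16 (R : realType) (k : nat) :
  exists d0 : nat, forall d : nat, (3 <= d)%N -> (d0 <= d)%N ->
  forall m : probability R R, is_cantor_measure d m ->
    let nu := convolution_pow m (d + k) in
    let nu_pi := torus_quotient_measure nu in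
    local_dims nu_pi (measure_support nu_pi) `<`
    local_dims nu (measure_support nu `\` [set 0; (d + k)%:R]).
Proof.
(* The threshold of [prod_min_bin_gt], which also exceeds [5 * k + 20]. *)
exists (2 * (k.+2 * (k + 7)) * (2 * (k.+2 * (k + 7))).+1 + 5 * k + 20)%N.
move=> d _ d0 m m_cantor nu nu_pi.
have d_large : (5 * k + 20 <= d)%N by lia.
have QW : @bin_weight R (d + k) k.+2 ^+ d.-1 <
    \prod_(j < d.-1) Num.min (bin_weight (d + k) j) (bin_weight (d + k) j.+1).
  have minE j : Num.min (@bin_weight R (d + k) j) (bin_weight (d + k) j.+1) =
      (minn 'C(d + k, j) 'C(d + k, j.+1))%:R / 2 ^+ (d + k).
    by rewrite /bin_weight -minr_pMl ?invr_ge0 ?exprn_ge0// natr_min.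
  rewrite (eq_bigr _ (fun (j : 'I_d.-1) _ => minE j)) big_split/= prodr_const card_ord.
  rewrite /bin_weight exprMn ltr_pM2r ?exprn_gt0 ?invr_gt0 ?exprn_gt0//.
  by rewrite -natr_prod -natrX ltr_nat; exact: prod_min_bin_gt.
have ld := @ln_d_gt0 R _ _ d_large.
split.
  move=> l [x _ /(torus_local_dim_bounds d_large m_cantor QW)/andP[l1 l2]].
  by apply: local_dim_attained => //; rewrite l1 ltW.
move=> sub.
(* The top endpoint separates the two sets: it is attained by [nu], whereas the upper bound on the
   torus is strict. *)
pose beta := - ln (@bin_weight R (d + k) k.+2) / ln d%:R.
have betaE : beta * ln d%:R = - ln (bin_weight (d + k) k.+2).
  by rewrite /beta divfK// gt_eqF; [|exact: ld].
have [x _] : local_dims nu_pi (measure_support nu_pi) beta.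
  apply/sub; apply: local_dim_attained => //; rewrite betaE.
  apply/andP; split => //; rewrite lerN2 ler_ln ?posrE; last 2 first.
  - by apply: bin_weight_gt0; clear -d_large; lia.
  - by apply: bin_weight_gt0; clear; lia.
  by apply: ler_bin_weight; exact: leq_bin_half.
move=> /(torus_local_dim_bounds d_large m_cantor QW).
by rewrite betaE ltxx andbF.
Qed.
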